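(* Let $c$ be a market participant and let $X_c \subseteq \mathbb{R}\times\mathbb{R}^{I_c}$ be its feasible set, i.e. the set of all $(u_c, x_c)$, $x_c = (x_{ic})_{ic\in I_c}$, such that \begin{align*} &\text{(0)}\quad u_c \in \mathbb{Z},\\ &\text{(1)}\quad x_{ic} \leq u_c \quad \forall ic \in I_c,\\ &\text{(2)}\quad x_{ic} \geq r_{ic} u_c \quad \forall ic \in I_c,\\ &\text{(3)}\quad u_c \leq 1,\\ &\text{(4)}\quad u_c \geq 0,\\ &\text{(5)}\quad \sum_{ic \in I_c \mid t(ic)=t+1} (-Q_{ic})x_{ic} - \sum_{ic\in I_c\mid t(ic)=t} (-Q_{ic})x_{ic} \leq RU_c\, u_c \quad \forall t\in\{1,\dots,T-1\},\\ &\text{(6)}\quad \sum_{ic \in I_c \mid t(ic)=t} (-Q_{ic})x_{ic} - \sum_{ic\in I_c\mid t(ic)=t+1} (-Q_{ic})x_{ic} \leq RD_c\, u_c \quad \forall t\in\{1,\dots,T-1\}. \end{align*} Then $\mathrm{conv}(X_c)$ is given by the continuous relaxation of $X_c$, i.e. $\mathrm{conv}(X_c)$ is exactly the set of $(u_c,x_c)\in\mathbb{R}\times\mathbb{R}^{I_c}$ satisfying (1)–(6).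
   Context: $I_c$ is a finite set indexing the bids (or steps of bid curves) $ic$ of participant $c$; each $ic \in I_c$ is associated with a time period $t(ic) \in \{1,\dots,T\}$, a bid quantity $Q_{ic}\in\mathbb{R}$ ($Q_{ic}<0$ for production, $Q_{ic}>0$ for consumption), and a minimum acceptance ratio $r_{ic}\in[0,1]$. $RU_c$ and $RD_c$ are real parameters (ramp-up and ramp-down limits). $u_c$ is the commitment variable and $x_{ic}$ the acceptance level of bid $ic$. $\mathrm{conv}$ denotes the convex hull. *)

(* Defs.v *)
From HB Require Import structures.
From mathcomp Require Import all_boot all_order all_algebra.
From mathcomp Require Import all_classical all_reals all_analysis.

Set Implicit Arguments.
Unset Strict Implicit.
Unset Printing Implicit Defensive.
Import Order.TTheory GRing.Theory Num.Theory.
Local Open Scope classical_set_scope.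
Local Open Scope ring_scope.

(* Time periods are the naturals 1, ..., T. *)
Record participant (R : realType) (T : nat) := Participant {
  bid : finType;
  period : bid -> nat;
  period_range : forall i, (1 <= period i <= T)%N;
  quantity : bid -> R;
  min_ratio : bid -> R;
  min_ratio_range : forall i, 0 <= min_ratio i <= 1;
  ramp_up : R;
  ramp_down : R
}.

(* The pairs (u_c, x_c); R^o is R seen as a module over itself, which gives
   the product its structure of real vector space. *)
Definition decision (R : realType) (T : nat) (c : participant R T) :=
  (R^o * {ffun bid c -> R^o})%type.

Section Feasibility.
Variables (R : realType) (T : nat) (c : participant R T).

(* Negative quantities are productions, hence the sign. *)
Definition output (x : {ffun bid c -> R^o}) (t : nat) : R :=
  \sum_(i | period i == t) (- quantity i) * x i.

Definition continuous_relaxation : set (decision c) := [set v : decision c |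
  [/\ forall i, v.2 i <= v.1,
      forall i, min_ratio i * v.1 <= v.2 i,
      0 <= v.1 <= 1,
      forall t : nat, (1 <= t < T)%N ->
        output v.2 t.+1 - output v.2 t <= ramp_up c * v.1 &
      forall t : nat, (1 <= t < T)%N ->
        output v.2 t - output v.2 t.+1 <= ramp_down c * v.1]].

Definition feasible_set : set (decision c) :=
  [set v | v.1 \is a Num.int] `&` continuous_relaxation.

End Feasibility.

Arguments continuous_relaxation {R T} c _.
Arguments feasible_set {R T} c _.

Definition convex_hull (R : realType) (E : lmodType R) (X : set E) : set E :=
  smallest (@convex_set R E) X.

(* Main.v *)
(** The constraints other than [u <= 1] are homogeneous and define a convex
    cone.  A point of the relaxation with [u = 0] is therefore [0], and a point
    with [u > 0] is the convex combination, with weights [u] and [1 - u], of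
    the feasible points [(1, u^-1 x)] and [0]. *)
Require Import Defs.
From mathcomp Require Import all_boot all_order all_algebra.
From mathcomp Require Import all_classical all_reals all_analysis.

Set Implicit Arguments.
Unset Strict Implicit.
Unset Printing Implicit Defensive.
Import Order.TTheory GRing.Theory Num.Theory.
Local Open Scope classical_set_scope.
Local Open Scope ring_scope.

Section Relaxation.
Variables (R : realType) (T : nat) (c : participant R T).
Implicit Types (v w : decision c) (x y : {ffun bid c -> R^o}).

Lemma output_linear (a b : R) x y t :
  output (a *: x + b *: y) t = a * output x t + b * output y t.
Proof.
rewrite /output !mulr_sumr -big_split /=; apply: eq_bigr => i _.
(* Scaling in [R^o] is multiplication up to conversion, so [mulrCA] applies to a term with [*:]. *)
by rewrite !ffunE mulrDr; congr (_ + _); exact: mulrCA.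
Qed.

(** The weights need not sum to 1, so the lemma covers both convex combinations and rescaling by
    [u^-1], which may exceed 1. The bound by 1 is assumed because it alone is not homogeneous. *)
Lemma continuous_relaxation_comb (a b : R) v w : 0 <= a -> 0 <= b ->
  a * v.1 + b * w.1 <= 1 ->
  continuous_relaxation c v -> continuous_relaxation c w ->
  continuous_relaxation c (a *: v + b *: w).
Proof.
move=> a0 b0 ab1 [v1 v2 /andP[v3 _] v4 v5] [w1 w2 /andP[w3 _] w4 w5].
have comb_le (p q r s : R) : p <= q -> r <= s -> a * p + b * r <= a * q + b * s.
  by move=> pq rs; rewrite lerD ?ler_wpM2l.
have coefE (r : R) : r * (a *: v.1 + b *: w.1) = a * (r * v.1) + b * (r * w.1).
  by rewrite mulrDr; congr (_ + _); exact: mulrCA.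
split => [i|i||t tT|t tT] /=.
- by rewrite !ffunE; exact: comb_le.
- by rewrite !ffunE coefE; exact: comb_le.
- by rewrite ab1 addr_ge0 ?mulr_ge0.
- rewrite !output_linear opprD addrACA -!mulrBr coefE.
  exact: comb_le (v4 t tT) (w4 t tT).
- rewrite !output_linear opprD addrACA -!mulrBr coefE.
  exact: comb_le (v5 t tT) (w5 t tT).
Qed.

Lemma continuous_relaxation0 : continuous_relaxation c 0.
Proof.
have output0 t : output (0 : {ffun bid c -> R^o}) t = 0.
  by rewrite /output big1 // => i _; rewrite ffunE mulr0.
by split => [i|i||t _|t _] /=; rewrite ?output0 ?ffunE ?mulr0 ?subrr ?lexx ?ler01.
Qed.

(** At [u = 0] the two acceptance bounds squeeze every [x i] between 0 and 0. *)
Lemma continuous_relaxation_eq0 v :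
  continuous_relaxation c v -> v.1 = 0 -> v = 0.
Proof.
case: v => u x [/= xu rux _ _ _] u0; congr (_, _); first exact: u0.
apply/ffunP => i; apply/eqP; rewrite ffunE eq_le -{1}u0 xu /=.
by have := rux i; rewrite u0 mulr0.
Qed.

Lemma convex_continuous_relaxation : convex_set (continuous_relaxation c).
Proof.
move=> v w l /set_mem vC /set_mem wC; apply/mem_set.
have l0 : 0 <= l%:num by [].
have l1 : l%:num <= 1 :> R by [].
apply: continuous_relaxation_comb => //; first by rewrite subr_ge0.
have [_ _ /andP[_ v1] _ _] := vC; have [_ _ /andP[_ w1] _ _] := wC.
(* Write 1 as [l + (1 - l)] and compare term by term. *)
by rewrite -[leRHS](subrKC l%:num) lerD// ler_piMr// subr_ge0.
Qed.

End Relaxation.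

Theorem theorem2 (R : realType) (T : nat) (c : participant R T) :
  convex_hull (feasible_set c) = continuous_relaxation c.
Proof.
apply/seteqP; split.
  by apply: smallest_sub; [exact: convex_continuous_relaxation | move=> v []].
have feasible0 : feasible_set c 0.
  by split; [exact: rpred0 | exact: continuous_relaxation0].
(* The hull is an intersection, so [v] must lie in every convex [K] containing the feasible set. *)
move=> v vC K [Kconvex XK].
have [u0|u_neq0] := eqVneq v.1 0.
  by rewrite (continuous_relaxation_eq0 vC u0); exact: XK.
have [_ _ /andP[u_ge0 u_le1] _ _] := vC.
have feasible1 : feasible_set c (v.1^-1 *: v).
  have uu : v.1^-1 * v.1 = 1 by rewrite mulVf.
  split; first by rewrite /= [_ *: _]uu rpred1.
  (* Append [1 *: 0] to turn the scaling into a conic combination. *)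
  rewrite -[_ *: v]addr0 -[X in _ + X](scaler0 _ 1).
  apply: continuous_relaxation_comb => //=; first by rewrite invr_ge0.
    by rewrite mulr0 addr0 uu.
  exact: continuous_relaxation0.
have := Kconvex (v.1^-1 *: v) 0 (Itv01 u_ge0 u_le1) (mem_set (XK _ feasible1))
  (mem_set (XK _ feasible0)).
move/set_mem; congr (K _).
(* The abstract convex combination unfolds to this sum by conversion. *)
rewrite [LHS](_ : _ = v.1 *: (v.1^-1 *: v) + (1 - v.1) *: 0) //.
by rewrite scaler0 addr0 scalerA mulfV// scale1r.
Qed.
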